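(* Let $1<\alpha\le2$, $\beta\in\mathbb{R}$, and let $U^n\in\mathcal{V}_h$, $0\le n\le N_t$, satisfy the scheme $$\mathrm{i}\,\delta_t^+U^n-D_\alpha U^{n+1/2}+F(U^n,U^{n+1})=0,\qquad 0\le n\le N_t-1.$$ Then the scheme is conservative in the sense that $$M^n=M^0,\qquad E^n=E^0,\qquad 0\le n\le N_t,$$ where $$M^n:=\|U^n\|_h^2,\qquad E^n:=|U^n|^2_{H^{\alpha/2}_h}-\frac{\beta}{2}\|U^n\|^4_{l^4_h}.$$
   Context: Let $\Omega=[a,b]$, $L=b-a$, $\mu=2\pi/L$, $N$ an even positive integer, $h=L/N$, $x_j=a+jh$; $T>0$, $N_t$ a positive integer, $\tau=T/N_t$. $\mathcal{V}_h$ is the space of complex-valued grid functions $u=(u_j)$, $j=0,\dots,N-1$ (extended periodically, $u_N=u_0$). $\delta_t^+U^n=(U^{n+1}-U^n)/\tau$ and $U^{n+1/2}=\frac12(U^{n+1}+U^n)$. Inner product and norms: $(u,v)_h=\frac1N\sum_{j=0}^{N-1}u_j\overline{v}_j$, $\|u\|_h^2=(u,u)_h$, $\|u\|_{l^p_h}^p=\frac1N\sum_{j=0}^{N-1}|u_j|^p$. Discrete Fourier coefficients: $\widehat u_k=\frac1N\sum_{j=0}^{N-1}u_je^{-\mathrm{i}k\mu x_j}$, $-N/2\le k\le N/2-1$, so that $u_j=\sum_{k=-N/2}^{N/2-1}\widehat u_ke^{\mathrm{i}k\mu x_j}$. Semi-norm: $|u|^2_{H^\sigma_h}=\sum_{k=-N/2}^{N/2-1}|\mu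 k|^{2\sigma}|\widehat u_k|^2$. Discrete fractional Laplacian: $(D_\alpha u)_j=\sum_{k=-N/2}^{N/2-1}|\mu k|^\alpha\widehat u_ke^{\mathrm{i}k\mu x_j}$. Nonlinear term: $F(U^n,U^{n+1})_j=\frac\beta4\big(|U^n_j|^2+|U^{n+1}_j|^2\big)\big(U^n_j+U^{n+1}_j\big)$. *)

(* Defs.v *)
From HB Require Import structures.
From mathcomp Require Import all_boot all_order all_algebra.
From mathcomp Require Import all_classical all_reals all_analysis.
From mathcomp Require Export complex.
Import Order.TTheory GRing.Theory Num.Theory.

Set Implicit Arguments.
Unset Strict Implicit.
Unset Printing Implicit Defensive.

Local Open Scope ring_scope.
Local Open Scope complex_scope.

(* Real-valued modulus: the norm `|z| of R[i] takes its values in R[i]. *)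
Definition cmod (R : realType) (z : R[i]) : R := ComplexField.Normc.normc z.

(* exp(i t) *)
Definition expi (R : realType) (t : R) : R[i] := cos t +i* sin t.

(* The values u_0, ..., u_{N-1} over one period. *)
Definition grid (R : realType) (N : nat) := {ffun 'I_N -> R[i]}.

Section Mesh.
Context {R : realType}.
Variables (a b : R) (N : nat).

Definition mu : R := 2 * pi / (b - a).
Definition mesh_h : R := (b - a) / N%:R.
Definition node (j : 'I_N) : R := a + j%:R * mesh_h.

(* For N even, the wavenumbers k = -N/2, ..., N/2 - 1 as l runs over 'I_N. *)
Definition wave (l : 'I_N) : int := l%:Z - (N./2)%:Z.

Definition inner_h (u v : grid R N) : R[i] :=
  N%:R^-1 * \sum_(j < N) u j * conjc (v j).

(* (u, u)_h is real and nonnegative, so taking its real part loses nothing. *)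
Definition norm_h (u : grid R N) : R := Num.sqrt (complex.Re (inner_h u u)).

Definition norm_lp (p : R) (u : grid R N) : R :=
  (N%:R^-1 * \sum_(j < N) cmod (u j) `^ p) `^ p^-1.

Definition fourier (u : grid R N) (k : int) : R[i] :=
  N%:R^-1 * \sum_(j < N) u j * expi (- (k%:~R * mu * node j)).

Definition seminorm_H (sigma : R) (u : grid R N) : R :=
  Num.sqrt (\sum_(l < N) `|mu * (wave l)%:~R| `^ (2 * sigma)
                         * cmod (fourier u (wave l)) ^+ 2).

Definition frac_lap (alpha : R) (u : grid R N) : grid R N :=
  [ffun j => \sum_(l < N) (`|mu * (wave l)%:~R| `^ alpha)%:C
               * fourier u (wave l) * expi ((wave l)%:~R * mu * node j)].

Definition delta_t (tau : R) (U : nat -> grid R N) (n : nat) : grid R N :=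
  [ffun j => (U n.+1 j - U n j) / tau%:C].

Definition half_step (U : nat -> grid R N) (n : nat) : grid R N :=
  [ffun j => (U n.+1 j + U n j) / 2].

Definition nonlin (beta : R) (u v : grid R N) : grid R N :=
  [ffun j => (beta / 4 * (cmod (u j) ^+ 2 + cmod (v j) ^+ 2))%:C
               * (u j + v j)].

Definition mass (u : grid R N) : R := norm_h u ^+ 2.

Definition energy (alpha beta : R) (u : grid R N) : R :=
  seminorm_H (alpha / 2) u ^+ 2 - beta / 2 * norm_lp 4 u ^+ 4.

End Mesh.

(* Main.v *)
Require Import Defs.
From mathcomp Require Import all_boot all_order all_algebra.
From mathcomp Require Import all_classical all_reals all_analysis.
From mathcomp Require Import ring lra.
Import Order.TTheory GRing.Theory Num.Theory.

Local Open Scope ring_scope.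
Local Open Scope complex_scope.

(** Multiply the scheme, for one time step from [u] to [v], by the conjugate of
    a test function [w] and average over the grid.  The fractional Laplacian is
    a nonnegative real Fourier multiplier, so this turns it into the Hermitian
    form [\sum_l d_l u^_l conj(w^_l)] with real weights [d_l].

    For [w = v + u], the Laplacian term, taken at the midpoint [(v + u) / 2],
    and the nonlinear term are both real, being real weights times squared
    moduli.  The imaginary part of the identity then says that the real part of
    [(v - u, v + u)_h], which is [mass v - mass u], vanishes.

    For [w = v - u], the time difference contributes ['i / tau * |v - u|^2],
    which is purely imaginary.  In the real part each remaining term telescopes:
    by [Re ((p + q) conj(p - q)) = |p|^2 - |q|^2], the Laplacian gives half the
    increment of the squared seminorm, and the nonlinearity gives
    [beta / 4 * (|u|^2 + |v|^2) * (|v|^2 - |u|^2) = beta / 4 * (|v|^4 - |u|^4)].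
    Twice their difference is the increment of the energy.

    The Hermitian form comes from [inner_frac_lap], by exchanging a sum over the
    modes with a sum over the grid; the time difference and the nonlinearity are
    treated pointwise on the grid. *)

Lemma Re_sum (R : realType) (I : finType) (F : I -> R[i]) :
  complex.Re (\sum_i F i) = \sum_i complex.Re (F i).
Proof. by apply: (big_morph (@complex.Re R)) => // -[x y] [z t]. Qed.

Lemma Im_sum (R : realType) (I : finType) (F : I -> R[i]) :
  complex.Im (\sum_i F i) = \sum_i complex.Im (F i).
Proof. by apply: (big_morph (@complex.Im R)) => // -[x y] [z t]. Qed.

Lemma Re_scale (R : realType) (r : R) (z : R[i]) :
  complex.Re (r%:C * z) = r * complex.Re z.
Proof. by case: z => x y /=; rewrite mul0r subr0. Qed.

Lemma Im_scale (R : realType) (r : R) (z : R[i]) :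
  complex.Im (r%:C * z) = r * complex.Im z.
Proof. by case: z => x y /=; rewrite mul0r addr0. Qed.

Lemma sqr_cmod (R : realType) (z : R[i]) :
  cmod z ^+ 2 = complex.Re z ^+ 2 + complex.Im z ^+ 2.
Proof. by case: z => x y; rewrite /cmod /= sqr_sqrtr ?addr_ge0 ?sqr_ge0. Qed.

Lemma Re_mul_conjc (R : realType) (z : R[i]) :
  complex.Re (z * conjc z) = cmod z ^+ 2.
Proof. by rewrite sqr_cmod; case: z => x y /=; ring. Qed.

Lemma Im_mul_conjc (R : realType) (z : R[i]) : complex.Im (z * conjc z) = 0.
Proof. by case: z => x y /=; ring. Qed.

(** The conjugate factor is the test function: this form serves the time
    difference tested against the sum, which conserves mass, and
    [Re_mul_conjcDB] the midpoint terms tested against the difference, which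
    conserve energy. *)
Lemma Re_mul_conjcBD (R : realType) (p q : R[i]) :
  complex.Re ((p - q) * conjc (p + q)) = cmod p ^+ 2 - cmod q ^+ 2.
Proof. by rewrite !sqr_cmod; case: p q => [x y] [z t] /=; ring. Qed.

Lemma Re_mul_conjcDB (R : realType) (p q : R[i]) :
  complex.Re ((p + q) * conjc (p - q)) = cmod p ^+ 2 - cmod q ^+ 2.
Proof. by rewrite !sqr_cmod; case: p q => [x y] [z t] /=; ring. Qed.

Lemma conjc_expi (R : realType) (t : R) : conjc (expi t) = expi (- t).
Proof. by rewrite /expi cosN sinN. Qed.

Lemma invr_natC (R : realType) (n : nat) : n%:R^-1 = (n%:R^-1)%:C :> R[i].
Proof. by rewrite fmorphV rmorph_nat. Qed.

Section Grid.
Context {R : realType} {N : nat}.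
Implicit Types (u v w : grid R N) (a b : R) (k : int).

Lemma fourierD a b u v k :
  fourier a b (u + v) k = fourier a b u k + fourier a b v k.
Proof.
rewrite /fourier -mulrDr -big_split /=; congr (_ * _).
by apply: eq_bigr => j _; rewrite ffunE mulrDl.
Qed.

Lemma fourierB a b u v k :
  fourier a b (u - v) k = fourier a b u k - fourier a b v k.
Proof.
rewrite /fourier -mulrBr -sumrB; congr (_ * _).
by apply: eq_bigr => j _; rewrite !ffunE mulrBl.
Qed.

Lemma fourier_midpoint a b (U : nat -> grid R N) n k :
  fourier a b (half_step U n) k
  = (2^-1)%:C * (fourier a b (U n.+1) k + fourier a b (U n) k).
Proof.
rewrite -fourierD /fourier [(2^-1)%:C * _]mulrCA; congr (_ * _).
rewrite mulr_sumr; apply: eq_bigr => j _.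
by rewrite !ffunE invr_natC [_ * (2^-1)%:C]mulrC -!mulrA.
Qed.

Lemma conjc_fourier a b w k :
  conjc (fourier a b w k)
  = N%:R^-1 * \sum_j conjc (w j) * expi (k%:~R * mu a b * node a b j).
Proof.
rewrite /fourier rmorphM rmorph_sum /= conjc_inv conjc_nat; congr (_ * _).
by apply: eq_bigr => j _; rewrite rmorphM [X in _ * X]conjc_expi opprK.
Qed.

Definition multiplier a b (alpha : R) (l : 'I_N) : R :=
  `|mu a b * (wave l)%:~R| `^ alpha.

(** Exchange the sums over grid points and modes: the inner sum over the grid
    is then the conjugate of a Fourier coefficient of [w], because conjugation
    flips the sign of the phase in [expi]. *)
Lemma inner_frac_lap a b alpha u w :
  inner_h (frac_lap a b alpha u) w
  = \sum_l (multiplier a b alpha l)%:C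
           * (fourier a b u (wave l) * conjc (fourier a b w (wave l))).
Proof.
rewrite /inner_h; under eq_bigr => j _ do rewrite ffunE mulr_suml.
rewrite exchange_big mulr_sumr; apply: eq_bigr => l _ /=.
rewrite conjc_fourier [fourier a b u _ * _]mulrCA [RHS]mulrCA; congr (_ * _).
rewrite [RHS]mulrA mulr_sumr; apply: eq_bigr => j _.
by rewrite /multiplier; ring.
Qed.

Definition dirichlet_form a b alpha u : R :=
  \sum_l multiplier a b alpha l * cmod (fourier a b u (wave l)) ^+ 2.

Definition mean_quartic u : R := N%:R^-1 * \sum_j cmod (u j) ^+ 4.

Lemma sqr_seminorm_H a b (alpha : R) u :
  seminorm_H a b (alpha / 2) u ^+ 2 = dirichlet_form a b alpha u.
Proof.
rewrite /seminorm_H sqr_sqrtr; last first.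
  by apply: sumr_ge0 => l _; rewrite mulr_ge0 ?powR_ge0 ?sqr_ge0.
have -> : 2 * (alpha / 2) = alpha by lra.
by [].
Qed.

Lemma norm_l4E u : norm_lp 4 u ^+ 4 = mean_quartic u.
Proof.
have c0 z : 0 <= cmod z :> R by case: z => x y; apply: sqrtr_ge0.
rewrite /norm_lp -powR_mulrn ?powR_ge0 // -powRrM mulVf ?pnatr_eq0 // powRr1.
  by congr (_ * _); apply: eq_bigr => j _; rewrite powR_mulrn.
by rewrite mulr_ge0 ?invr_ge0 ?sumr_ge0 // => j _; apply: powR_ge0.
Qed.

Lemma energyE a b alpha beta u :
  energy a b alpha beta u
  = dirichlet_form a b alpha u - beta / 2 * mean_quartic u.
Proof. by rewrite /energy norm_l4E sqr_seminorm_H. Qed.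

Lemma Re_inner u w :
  complex.Re (inner_h u w)
  = N%:R^-1 * \sum_j complex.Re (u j * conjc (w j)).
Proof. by rewrite /inner_h invr_natC Re_scale Re_sum. Qed.

Lemma Im_inner u w :
  complex.Im (inner_h u w)
  = N%:R^-1 * \sum_j complex.Im (u j * conjc (w j)).
Proof. by rewrite /inner_h invr_natC Im_scale Im_sum. Qed.

Lemma massE u : mass u = N%:R^-1 * \sum_j cmod (u j) ^+ 2.
Proof.
rewrite /mass /norm_h Re_inner; under eq_bigr do rewrite Re_mul_conjc.
by rewrite sqr_sqrtr // mulr_ge0 ?invr_ge0 ?sumr_ge0 // => j _; apply: sqr_ge0.
Qed.

Lemma Re_inner_BD u v : complex.Re (inner_h (v - u) (v + u)) = mass v - mass u.
Proof.
rewrite Re_inner !massE -mulrBr -sumrB; congr (_ * _).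
by apply: eq_bigr => j _; rewrite !ffunE Re_mul_conjcBD.
Qed.

Lemma Im_inner_self u : complex.Im (inner_h u u) = 0.
Proof. by rewrite Im_inner big1 ?mulr0 // => j _; apply: Im_mul_conjc. Qed.

Lemma Im_inner_frac_lap_midpoint a b alpha (U : nat -> grid R N) n :
  complex.Im (inner_h (frac_lap a b alpha (half_step U n)) (U n.+1 + U n)) = 0.
Proof.
rewrite inner_frac_lap Im_sum big1 // => l _.
by rewrite Im_scale fourier_midpoint fourierD -mulrA Im_scale Im_mul_conjc !mulr0.
Qed.

Lemma Re_inner_frac_lap_midpoint a b alpha (U : nat -> grid R N) n :
  complex.Re (inner_h (frac_lap a b alpha (half_step U n)) (U n.+1 - U n))
  = 2^-1 * (dirichlet_form a b alpha (U n.+1) - dirichlet_form a b alpha (U n)).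
Proof.
rewrite inner_frac_lap Re_sum -sumrB mulr_sumr.
apply: eq_bigr => l _.
rewrite Re_scale fourier_midpoint fourierB -mulrA Re_scale Re_mul_conjcDB.
by ring.
Qed.

Lemma Im_inner_nonlin beta u v : complex.Im (inner_h (nonlin beta u v) (v + u)) = 0.
Proof.
rewrite Im_inner big1 ?mulr0 // => j _.
by rewrite !ffunE [v j + _]addrC -mulrA Im_scale Im_mul_conjc mulr0.
Qed.

Lemma Re_inner_nonlin beta u v :
  complex.Re (inner_h (nonlin beta u v) (v - u))
  = beta / 4 * (mean_quartic v - mean_quartic u).
Proof.
rewrite Re_inner -mulrBr [RHS]mulrCA -sumrB; congr (_ * _).
rewrite mulr_sumr; apply: eq_bigr => j _.
rewrite !ffunE [u j + _]addrC -mulrA Re_scale Re_mul_conjcDB.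
by ring.
Qed.

Definition solves_step a b (tau alpha beta : R) (U : nat -> grid R N) n :=
  forall j : 'I_N,
    'i%C * delta_t tau U n j - frac_lap a b alpha (half_step U n) j
    + nonlin beta (U n) (U n.+1) j = 0.

(** The Laplacian and the nonlinearity stand alone on the right, so that for
    each of the two test functions one side drops out: the right one in the
    imaginary part of the sum test, the left one in the real part of the
    difference test. *)
Lemma scheme_weak_form {a b tau alpha beta} {U : nat -> grid R N} {n} w :
  solves_step a b tau alpha beta U n ->
  (tau^-1)%:C * ('i%C * inner_h (U n.+1 - U n) w)
  = inner_h (frac_lap a b alpha (half_step U n)) w
    - inner_h (nonlin beta (U n) (U n.+1)) w.
Proof.
move=> hU; rewrite /inner_h -mulrBr -sumrB.
rewrite [(tau^-1)%:C * _]mulrA [_ * (N%:R^-1 * _)]mulrCA; congr (_ * _).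
rewrite mulr_sumr; apply: eq_bigr => j _.
rewrite -mulrBl mulrA; congr (_ * _).
have /eqP := hU j; rewrite -addrA addr_eq0 opprD opprK => /eqP <-.
by rewrite !ffunE fmorphV; ring.
Qed.

Lemma mass_step a b tau alpha beta (U : nat -> grid R N) n :
  tau != 0 -> solves_step a b tau alpha beta U n -> mass (U n.+1) = mass (U n).
Proof.
move=> tau0 /(scheme_weak_form (U n.+1 + U n)) /(congr1 (@complex.Im R)).
rewrite Im_scale raddfB /= Im_inner_frac_lap_midpoint Im_inner_nonlin subr0.
rewrite [_ * inner_h _ _]mulrC ImiRe Re_inner_BD => /eqP.
by rewrite mulf_eq0 invr_eq0 (negPf tau0) /= subr_eq0 => /eqP.
Qed.

Lemma energy_step a b tau alpha beta (U : nat -> grid R N) n :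
  solves_step a b tau alpha beta U n ->
  energy a b alpha beta (U n.+1) = energy a b alpha beta (U n).
Proof.
move=> /(scheme_weak_form (U n.+1 - U n)) /(congr1 (@complex.Re R)).
rewrite Re_scale raddfB /= Re_inner_frac_lap_midpoint Re_inner_nonlin.
rewrite [_ * inner_h _ _]mulrC ReiNIm Im_inner_self oppr0 mulr0 !energyE.
by lra.
Qed.

End Grid.

Theorem theorem3p1 (R : realType) (a b : R) (hab : a < b)
  (N : nat) (hN : (0 < N)%N) (hNeven : ~~ odd N)
  (T : R) (hT : 0 < T) (Nt : nat) (hNt : (0 < Nt)%N)
  (alpha : R) (halpha1 : 1 < alpha) (halpha2 : alpha <= 2) (beta : R)
  (U : nat -> grid R N)
  (hU : forall n : nat, (n < Nt)%N -> forall j : 'I_N,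
      'i%C * delta_t (T / Nt%:R) U n j
      - frac_lap a b alpha (half_step U n) j
      + nonlin beta (U n) (U n.+1) j = 0) :
  forall n : nat, (n <= Nt)%N ->
    mass (U n) = mass (U 0%N)
    /\ energy a b alpha beta (U n) = energy a b alpha beta (U 0%N).
Proof.
have tau0 : T / Nt%:R != 0.
  by rewrite mulf_neq0 ?invr_eq0 ?pnatr_eq0 -?lt0n // gt_eqF.
elim=> [//|n IHn] lt_n_Nt; have [massIH energyIH] := IHn (ltnW lt_n_Nt).
split; first by rewrite (mass_step _ _ _ _ _ _ _ tau0 (hU n lt_n_Nt)).
by rewrite (energy_step _ _ _ _ _ _ _ (hU n lt_n_Nt)).
Qed.
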